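(* Let $A,B,C\in\mathbb{F}^{m\times m}$ and let $f:\mathbb{F}^{m\times m}\to\mathbb{F}^{m\times m}$ be a period-$2$, general linear, multiplication preserving matrix operator. Assume that $\sigma(Af(A))\cap\sigma(Bf(B))=\emptyset$. Put $\mathcal{A}:=f(A)A$, $\mathcal{B}:=f(B)B$ and $\mathcal{C}:=f(C)B-f(A)C$. Let $\mathrm{ch}_{\mathcal{A}}(\lambda):=\det(\lambda I_m-\mathcal{A})=\sum_{k=0}^m p_k\lambda^k$ and $\mathrm{ch}_{\mathcal{B}}(\lambda):=\det(\lambda I_m-\mathcal{B})=\sum_{k=0}^m q_k\lambda^k$ be the characteristic polynomials of $\mathcal{A}$ and $\mathcal{B}$. Then the matrix $\mathrm{ch}_{\mathcal{A}}(\mathcal{B})$ is nonsingular, and the unique solution $X\in\mathbb{F}^{m\times m}$ of $AX+f(X)B=C$ is $$X=\left(\sum_{i=1}^{m}\sum_{k=0}^{i-1}p_i\,\mathcal{A}^{k}\,\mathcal{C}\,\mathcal{B}^{i-k-1}\right)\mathrm{ch}_{\mathcal{A}}(\mathcal{B})^{-1}.$$ Moreover, the matrix $\mathrm{ch}_{\mathcal{B}}(\mathcal{A})$ is also nonsingular, and $$X=-\,\mathrm{ch}_{\mathcal{B}}(\mathcal{A})^{-1}\left(\sum_{i=1}^{m}\sum_{k=0}^{i-1}q_i\,\mathcal{A}^{k}\,\mathcal{C}\,\mathcal{B}^{i-k-1}\right).$$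
   Context: $\mathbb{F}$ is $\mathbb{R}$ or $\mathbb{C}$, and $m\ge 1$. The operator $f:\mathbb{F}^{m\times m}\to\mathbb{F}^{m\times m}$ is: - period-$2$ if $f(f(M))=M$ for all $M$; - multiplication preserving if $f(MN)=f(M)f(N)$ for all $M,N$; - general linear if $f(M+N)=f(M)+f(N)$ for all $M,N$ and there is an injective function $s:\mathbb{F}\to\mathbb{F}$ with $f(aM)=s(a)f(M)$ for all $a\in\mathbb{F}$ and all $M$. For a square matrix $M$, $\sigma(M)\subset\mathbb{C}$ is its set of (complex) eigenvalues. $I_m$ is the $m\times m$ identity matrix. *)

(* Defs.v *)
From HB Require Import structures.
From mathcomp Require Import all_boot all_order all_algebra.
From mathcomp Require Import complex.
From mathcomp Require Import classical_sets reals.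

Set Implicit Arguments.
Unset Strict Implicit.
Unset Printing Implicit Defensive.

Import Order.TTheory GRing.Theory Num.Theory.

Local Open Scope ring_scope.
Local Open Scope complex_scope.

Variant field_kind := Reals | Complexes.

Definition base_field (R : realType) (K : field_kind) : fieldType :=
  match K with Reals => R | Complexes => R[i] end.

Definition to_complex (R : realType) (K : field_kind) : base_field R K -> R[i] :=
  match K return base_field R K -> R[i] with
  | Reals => fun x => x%:C
  | Complexes => fun z => z
  end.

(* The eigenvalues are taken in R[i] also when M has real entries. *)
Definition spectrum (R : realType) (K : field_kind) (m : nat)
    (M : 'M[base_field R K]_m) : set R[i] :=
  [set z | eigenvalue (map_mx (@to_complex R K) M) z]%classic.

Definition period2 (F : fieldType) (m : nat) (f : 'M[F]_m -> 'M[F]_m) : Prop :=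
  forall M, f (f M) = M.

Definition mult_preserving (F : fieldType) (m : nat)
    (f : 'M[F]_m -> 'M[F]_m) : Prop :=
  forall M N, f (M *m N) = f M *m f N.

Definition general_linear (F : fieldType) (m : nat)
    (f : 'M[F]_m -> 'M[F]_m) : Prop :=
  (forall M N, f (M + N) = f M + f N) /\
  exists2 s : F -> F, injective s & forall a M, f (a *: M) = s a *: f M.

(* Main.v *)
(** Applying f to the equation A X + f(X) B = C gives f(A) f(X) + X f(B) = f(C);
    eliminating f(X) between the two leaves the Sylvester equation
    X cB - cA X = cC. Since M N and N M have the same characteristic polynomial,
    the spectral hypothesis makes the characteristic polynomials of cA and cB
    coprime, so by Bezout and Cayley-Hamilton ch_cA(cB) and ch_cB(cA) are
    invertible. Summing a^k (X b - a X) b^(i-k-1) telescopes to X b^i - a^i X,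
    which yields both closed formulas. Conversely, if X solves the Sylvester
    equation, then E := A X + f(X) B - C satisfies f(E) B = f(A) E, hence
    E (f(B) B) = (A f(A)) E, which forces E = 0. *)

Require Import Defs.
From mathcomp Require Import all_boot all_order all_algebra.
From mathcomp Require Import complex.
From mathcomp Require Import classical_sets reals.

Import GRing.Theory.

Local Open Scope ring_scope.

Set Implicit Arguments.
Unset Strict Implicit.

Section DividedDifference.
Variables (F : fieldType) (n : nat).
Implicit Types (a b c x : 'M[F]_n.+1) (p : {poly F}).

(* Noncommutative divided difference of [p]: when everything commutes it is
   [c * (p a - p b) / (a - b)]. *)
Definition divdiff m p a b c : 'M[F]_n.+1 :=
  \sum_(1 <= i < m.+1) \sum_(0 <= k < i)
     p`_i *: (a ^+ k *m c *m b ^+ (i - k - 1)).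

Lemma horner_mx_sum m p a : (size p <= m)%N ->
  horner_mx a p = \sum_(0 <= i < m) p`_i *: a ^+ i.
Proof.
move=> le_pm.
have -> : p = \poly_(i < m) p`_i.
  apply/polyP=> i; rewrite coef_poly; case: ltnP => // le_mi.
  by rewrite nth_default // (leq_trans le_pm).
rewrite poly_def raddf_sum /= big_mkord.
apply: eq_bigr => i _; rewrite linearZ rmorphXn /= horner_mx_X.
by rewrite -poly_def coef_poly ltn_ord.
Qed.

Lemma divdiff_commutator m p a b x : (size p <= m.+1)%N ->
  divdiff m p a b (x *m b - a *m x)
  = x *m horner_mx b p - horner_mx a p *m x.
Proof.
move=> le_pm; rewrite !(@horner_mx_sum m.+1) // mulmx_sumr mulmx_suml -sumrB.
(* The [i = 0] terms cancel because [x] commutes with scalars, which is why [divdiff] can start at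
   [i = 1]. *)
rewrite [RHS]big_ltn // !expr0 -scalemxAr -scalemxAl mulmx1 mul1mx subrr add0r.
apply: eq_big_nat => i _; rewrite -scalemxAr -scalemxAl -scalerBr -scaler_sumr.
congr (_ *: _); rewrite !mulmxE.
transitivity (- \sum_(0 <= k < i)
  (a ^+ k.+1 * x * b ^+ (i - k.+1) - a ^+ k * x * b ^+ (i - k))); last first.
  by rewrite telescope_sumr // subnn subn0 !expr0 mulr1 mul1r opprB.
rewrite -sumrN; apply: eq_big_nat => k /andP[_ lt_ki].
by rewrite opprB -subnDA addn1 -(subnSK lt_ki) exprS exprSr mulrBr mulrBl !mulrA.
Qed.

(** Left multiplication by [a] and right multiplication by [b] commute with each map sending [c] to
    [a ^+ k *m c *m b ^+ j]. This serves to check that the closed formula is a solution. *)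
Lemma divdiff_sylvester m p a b c :
  divdiff m p a b c *m b - a *m divdiff m p a b c
  = divdiff m p a b (c *m b - a *m c).
Proof.
rewrite /divdiff mulmx_suml mulmx_sumr -sumrB; apply: eq_bigr => i _.
rewrite mulmx_suml mulmx_sumr -sumrB; apply: eq_bigr => k _.
rewrite -scalemxAl -scalemxAr -scalerBr !mulmxE; congr (_ *: _).
by rewrite mulrBr mulrBl !mulrA -exprSr exprS -!mulrA -exprS -exprSr.
Qed.

End DividedDifference.

Lemma char_poly_mulC (R : comNzRingType) n (M N : 'M[R]_n) :
  char_poly (M *m N) = char_poly (N *m M).
Proof.
set M' := map_mx polyC M; set N' := map_mx polyC N.
(* Two triangularizations of one block matrix: its determinant is the left-hand
   side, and 'X^n times it is 'X^n times the right-hand side. *)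
have D1 : block_mx 'X%:M M' N' 1%:M *m block_mx 1%:M 0 (- N') 1%:M
        = block_mx (char_poly_mx (M *m N)) M' 0 1%:M.
  rewrite mulmx_block !mulmx1 !mulmx0 !mul1mx !add0r mulmxN subrr.
  by rewrite /char_poly_mx map_mxM.
have D2 : block_mx 'X%:M M' N' 1%:M *m block_mx 1%:M (- M') 0 'X%:M
        = block_mx 'X%:M 0 N' (char_poly_mx (N *m M)).
  rewrite mulmx_block !mulmx1 !mulmx0 !mul1mx !addr0 !mulmxN scalar_mxC addNr.
  by rewrite /char_poly_mx map_mxM addrC.
move/(congr1 determinant): D1; move/(congr1 determinant): D2.
rewrite !det_mulmx !det_ublock !det_lblock !det1 !mul1r !mulr1 !det_scalar.
move=> eqX eqD; move: eqX; rewrite eqD mulrC.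
(* ['X^n] is monic, hence cancellable even when [R] has zero divisors. *)
exact/monic_lreg/monicXn.
Qed.

(** Coprimality is unchanged by extension to [L], where it amounts to having no common root. *)
Lemma coprime_char_poly (F : fieldType) (L : closedFieldType)
    (phi : {rmorphism F -> L}) n (M N : 'M[F]_n) :
  (forall z, eigenvalue (map_mx phi M) z -> ~~ eigenvalue (map_mx phi N) z) ->
  coprimep (char_poly M) (char_poly N).
Proof.
move=> disjMN; rewrite -(coprimep_map phi) !map_char_poly.
apply/Pdiv.ClosedField.root_coprimep => z.
by rewrite -eigenvalue_root_char => /disjMN; rewrite eigenvalue_root_char.
Qed.

Lemma coprimep_horner_unitmx (F : fieldType) n (M : 'M[F]_n.+1) (p q : {poly F}) :
  coprimep p q -> horner_mx M q = 0 -> horner_mx M p \in unitmx.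
Proof.
move=> /Bezout_eq1_coprimepP[[u v] /= uv1] qM0.
move/(congr1 (horner_mx M)): uv1; rewrite rmorphD !rmorphM rmorph1 /= qM0 mulr0.
by rewrite addr0 => /mulmx1_unit[].
Qed.

Section Sylvester.
Variables (F : fieldType) (n : nat) (a b : 'M[F]_n.+1).
Hypothesis coprime_ab : coprimep (char_poly a) (char_poly b).

Lemma unitmx_horner_char_polyl : horner_mx b (char_poly a) \in unitmx.
Proof. exact: coprimep_horner_unitmx coprime_ab (Cayley_Hamilton b). Qed.

Lemma unitmx_horner_char_polyr : horner_mx a (char_poly b) \in unitmx.
Proof.
by apply: coprimep_horner_unitmx (Cayley_Hamilton a); rewrite coprimep_sym.
Qed.

Lemma sylvester_eqr c x : x *m b - a *m x = c ->
  x = divdiff n.+1 (char_poly a) a b c *m invmx (horner_mx b (char_poly a)).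
Proof.
move=> <-; rewrite divdiff_commutator ?size_char_poly // Cayley_Hamilton.
by rewrite mul0mx subr0 mulmxK // unitmx_horner_char_polyl.
Qed.

Lemma sylvester_eql c x : x *m b - a *m x = c ->
  x = - (invmx (horner_mx a (char_poly b)) *m divdiff n.+1 (char_poly b) a b c).
Proof.
move=> <-; rewrite divdiff_commutator ?size_char_poly // Cayley_Hamilton.
by rewrite mulmx0 sub0r mulmxN opprK mulKmx // unitmx_horner_char_polyr.
Qed.

Lemma sylvester_ex c : exists x, x *m b - a *m x = c.
Proof.
set p := char_poly a; set h := horner_mx b p.
exists (divdiff n.+1 p a b c *m invmx h).
have unit_h : h \in unitmx by exact: unitmx_horner_char_polyl.
have comm_h : h *m b = b *m h by apply: comm_horner_mx.
have commV : invmx h *m b = b *m invmx h.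
  by rewrite -[LHS](mulmxK unit_h) -(mulmxA _ b) -comm_h mulKmx.
(* As [invmx h] commutes with [b], it factors out on the right and then cancels the [h] of the
   telescoped sum [c *m h]. *)
rewrite -mulmxA commV !mulmxA -mulmxBl divdiff_sylvester.
rewrite divdiff_commutator ?size_char_poly //.
by rewrite Cayley_Hamilton mul0mx subr0 mulmxK.
Qed.

Lemma sylvester_inj x : x *m b = a *m x -> x = 0.
Proof.
(* Writing zero as [0 *m b - a *m 0] makes [0] a solution by reflexivity, so the closed formula
   gives [x] and [0] the same value. *)
move=> xba; have := @sylvester_eqr (0 *m b - a *m 0) x.
rewrite -(@sylvester_eqr _ 0) //; apply.
by rewrite xba subrr mul0mx mulmx0 subrr.
Qed.

End Sylvester.

Lemma coprime_spectra (R : realType) (K : field_kind) n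
    (M N : 'M[base_field R K]_n) :
  (spectrum M `&` spectrum N = set0)%classic ->
  coprimep (char_poly M) (char_poly N).
Proof.
move=> disjMN.
have {disjMN} disjMN z : eigenvalue (map_mx (@to_complex R K) M) z ->
    ~~ eigenvalue (map_mx (@to_complex R K) N) z.
  move=> zM; apply/negP => zN.
  suff : (set0 : set R[i]%C) z by [].
  by rewrite -disjMN; exact: (conj zM zN).
(* Only for a fixed [K] does [to_complex] become a known ring morphism: the embedding of the reals
   or the identity. *)
case: K M N disjMN => M N disjMN.
  have := @coprime_char_poly (base_field R Reals) R[i]%C (real_complex R) n M N.
  by apply; exact: disjMN.
have := @coprime_char_poly (base_field R Complexes) R[i]%C idfun n M N.
by apply; exact: disjMN.
Qed.

Unset Implicit Arguments.
Set Strict Implicit.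

Theorem theorem3p1 (R : realType) (K : field_kind) (n : nat)
    (A B C : 'M[base_field R K]_n.+1)
    (f : 'M[base_field R K]_n.+1 -> 'M[base_field R K]_n.+1)
    (f_period2 : period2 f) (f_linear : general_linear f)
    (f_mult : mult_preserving f)
    (disjoint_spectra :
      (spectrum (A *m f A) `&` spectrum (B *m f B) = set0)%classic) :
  let m := n.+1 in
  let cA := f A *m A in
  let cB := f B *m B in
  let cC := f C *m B - f A *m C in
  let chA := char_poly cA in
  let chB := char_poly cB in
  let p k := chA`_k in
  let q k := chB`_k in
  [/\ horner_mx cB chA \in unitmx,
      horner_mx cA chB \in unitmx
    & exists X : 'M[base_field R K]_n.+1,
      [/\ A *m X + f X *m B = C,
          forall Y, A *m Y + f Y *m B = C -> Y = X,
          X = (\sum_(1 <= i < m.+1) \sum_(0 <= k < i)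
                 p i *: (cA ^+ k *m cC *m cB ^+ (i - k - 1)))
              *m invmx (horner_mx cB chA)
        & X = - (invmx (horner_mx cA chB)
              *m (\sum_(1 <= i < m.+1) \sum_(0 <= k < i)
                 q i *: (cA ^+ k *m cC *m cB ^+ (i - k - 1))))]].
Proof.
case: f_linear => fD _ m cA cB cC chA chB p q.
have f0 : f 0 = 0 by apply: (addrI (f 0)); rewrite -fD !addr0.
have fN M : f (- M) = - f M by apply: (addrI (f M)); rewrite -fD !subrr.
have coAB : coprimep chA chB.
  by rewrite /chA /chB !(char_poly_mulC (f _)); exact: coprime_spectra.
(* The equation for the residual at the end has [A *m f A], not [cA], on its left. *)
have coAfA : coprimep (char_poly (A *m f A)) chB by rewrite -char_poly_mulC.
(* The term [f A *m f X *m B] occurs on both sides of the difference and cancels. *)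
have residual X : let E := A *m X + f X *m B - C in
    f E *m B - f A *m E = X *m cB - cA *m X - cC.
  rewrite /= !fD fN !f_mult f_period2 mulmxBr mulmxBl mulmxDl mulmxDr !mulmxA.
  rewrite /cC /cA /cB.
  have cancel (P Q S U V : 'M[base_field R K]_n.+1) :
      P + Q - U - (V + P - S) = Q - V - (U - S).
    rewrite opprB opprD !addrA (ACl (2*5*4*3*(1*6))%AC) /= subrr addr0.
    by rewrite opprB addrA.
  by rewrite cancel.
have sylv Y : A *m Y + f Y *m B = C -> Y *m cB - cA *m Y = cC.
  move=> eqY; apply/eqP; rewrite -subr_eq0 -residual eqY subrr f0.
  by rewrite mul0mx mulmx0 subrr.
have [X eqX] := sylvester_ex coAB cC.
split.
- exact: unitmx_horner_char_polyl.
- exact: unitmx_horner_char_polyr.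
exists X; split.
- have := residual X; rewrite eqX subrr /=; set E := _ - C => /subr0_eq fEB.
  (* This is the image under [f] of [f E *m B = f A *m E]. *)
  have EfB : E *m f B = A *m f E.
    by rewrite -[E in LHS]f_period2 -f_mult fEB f_mult f_period2.
  apply/subr0_eq/(sylvester_inj coAfA).
  by rewrite /cB mulmxA EfB -!mulmxA fEB.
- by move=> Y /sylv/(sylvester_eqr coAB) ->; rewrite -(sylvester_eqr coAB eqX).
- exact: sylvester_eqr.
- exact: sylvester_eql.
Qed.
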